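(* There is an absolute constant $C>0$ such that for all integers $T\ge 2$ and $d\ge 1$ there exists an efficient forecasting algorithm for the $T$-round online protocol with context space $\mathcal X=\{x\in\mathbb R^d:\|x\|_2\le 1,\ x_1=\tfrac12\}$ (making predictions in $\mathcal Z=\{0,\frac1N,\dots,\frac{N-1}{N},1\}$ for a suitable positive integer $N$ chosen by the algorithm) such that, for every oblivious adversary and every $\delta\in(0,1)$, with probability at least $1-\delta$, $$\mathsf{SMCal}_{\mathcal F_1^{\mathrm{lin}},1}\le C\left(T^{\frac23}d^{\frac13}(\log T)^{\frac13}+T^{\frac23}(d\log T)^{-\frac16}\sqrt{\log\frac1\delta}\right).$$ Furthermore, $\mathbb E\big[\mathsf{SMCal}_{\mathcal F_1^{\mathrm{lin}},1}\big]\le C\,T^{\frac23}d^{\frac13}(\log T)^{\frac13}$, where the expectation is over the internal randomness of the algorithm.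
   Context: Online protocol. There are $T$ rounds ($T$ known). An oblivious adversary fixes a sequence $(x_1,y_1),\dots,(x_T,y_T)\in\mathcal X\times\{0,1\}$ in advance (knowing the forecaster's algorithm but not its random draws). In round $t$: the context $x_t$ is revealed; the forecaster chooses a distribution $\mathcal P_t$ on $\mathcal Z$ and draws a prediction $p_t\sim\mathcal P_t$; then $y_t$ is revealed. Function class. $\mathcal F^{\mathrm{lin}}=\{x\mapsto\langle\theta,x\rangle:\theta\in\mathbb R^d\}$ and $\mathcal F_1^{\mathrm{lin}}=\{f\in\mathcal F^{\mathrm{lin}}: f(x)^2\le 1\ \text{for all }x\in\mathcal X\}$. Swap multicalibration. For $p\in\mathcal Z$ and $f:\mathcal X\to\mathbb R$ let $$\rho_{p,f}=\frac{\sum_{t=1}^T\mathbb I[p_t=p]\,f(x_t)(y_t-p)}{\sum_{t=1}^T\mathbb I[p_t=p]}$$ (with value $0$ if the denominator is $0$). For $q\ge 1$, the $\ell_q$-swap multicalibration error is $$\mathsf{SMCal}_{\mathcal F,q}=\sum_{p\in\mathcal Z}\Big(\sum_{t=1}^T\mathbb I[p_t=p]\Big)\sup_{f\in\mathcal F}|\rho_{p,f}|^q .$$ ''Efficient'' means running time polynomial in $T$ and $d$. *)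

(* Defs.v *)
From HB Require Import structures.
From mathcomp Require Import all_boot all_order all_algebra.
From mathcomp Require Import all_classical all_reals all_analysis.

Set Implicit Arguments.
Unset Strict Implicit.
Unset Printing Implicit Defensive.

Import Order.TTheory GRing.Theory Num.Theory.

Local Open Scope classical_set_scope.
Local Open Scope ring_scope.

Section Contexts.
Context {R : realType} {d : nat}.

Definition dot (u v : 'rV[R]_d) : R := \sum_(i < d) u 0 i * v 0 i.

(* The norm that the library puts on matrices is the sup norm, hence this
   definition. *)
Definition l2norm (u : 'rV[R]_d) : R := Num.sqrt (dot u u).

(* The coordinate x_1 of the usual 1-based notation has index 0 here. *)
Definition context_space : set 'rV[R]_d :=
  [set x | l2norm x <= 1 /\ forall i : 'I_d, i = 0%N :> nat -> x 0 i = 1 / 2].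

Definition Flin : set ('rV[R]_d -> R) := range (fun theta => dot theta).

Definition Flin1 : set ('rV[R]_d -> R) :=
  [set f | Flin f /\ forall x, context_space x -> f x ^+ 2 <= 1].

End Contexts.

(* A prediction i / N is represented by its index i : 'I_N.+1. *)
Definition gridpt {R : realType} (N : nat) (i : 'I_N.+1) : R := i%:R / N%:R.

Section SwapMulticalibration.
Context {R : realType} {X : Type} {T N : nat}.
Variables (x : T.-tuple X) (y : T.-tuple bool) (p : T.-tuple 'I_N.+1).

Definition npred (i : 'I_N.+1) : R := \sum_(t < T) (tnth p t == i)%:R.

(* The convention 0^-1 = 0 gives the value 0 when i is never predicted. *)
Definition rho (i : 'I_N.+1) (f : X -> R) : R :=
  (\sum_(t < T) (tnth p t == i)%:R * f (tnth x t)
                * ((tnth y t)%:R - gridpt i)) / npred i.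

Definition SMCal (F : set (X -> R)) (q : R) : \bar R :=
  (\sum_(i < N.+1)
     (npred i)%:E * ereal_sup [set (`|rho i f| `^ q)%:E | f in F])%E.

End SwapMulticalibration.

(* In round t (counted from 0), [law xs ys ps] is the distribution of the next
   prediction, where xs lists the t+1 contexts revealed so far, and ys and ps
   list the t past outcomes and the t past (drawn) predictions. *)
Record forecaster (R : realType) (d : nat) := Forecaster {
  grid : nat;
  grid_gt0 : (0 < grid)%N;
  law : seq 'rV[R]_d -> seq bool -> seq 'I_grid.+1 -> 'I_grid.+1 -> R;
  law_ge0 : forall xs ys ps i, 0 <= law xs ys ps i;
  law_sum1 : forall xs ys ps, \sum_(i < grid.+1) law xs ys ps i = 1
}.

Section Protocol.
Context {R : realType} {d : nat} (A : forecaster R d) {T : nat}.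
Variables (x : T.-tuple 'rV[R]_d) (y : T.-tuple bool).

(* Probability that the predictions drawn over the T rounds are exactly p,
   against the oblivious adversary (x, y). *)
Definition run_prob (p : T.-tuple 'I_(grid A).+1) : R :=
  \prod_(t < T) law (take t.+1 x) (take t y) (take t p) (tnth p t).

Definition Pr (E : pred (T.-tuple 'I_(grid A).+1)) : R :=
  \sum_(p | E p) run_prob p.

Definition Expect (g : T.-tuple 'I_(grid A).+1 -> \bar R) : \bar R :=
  (\sum_p (run_prob p)%:E * g p)%E.

End Protocol.

(* Real RAM: a memory of integer cells and a memory of real cells, a cell being
   addressed by an array name and a list of integer indices (the empty list for
   a scalar).  Real cells support exact field operations and comparisons at
   unit cost.  Integer operations are limited to addition and truncated
   subtraction: unit-cost integer multiplication or a unit-cost floor from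
   reals to integers would make polynomial time unreasonably powerful.  The
   only constants are integers.  Loops are bounded by the value of an integer
   expression on entry; they can be exponentially long, so that running time
   has to be bounded separately. *)
Inductive nexp : Type :=
| NConst of nat
| NCell of nat & seq nexp
| NAdd of nexp & nexp
| NSub of nexp & nexp.

Inductive rexp : Type :=
| RNat of nexp
| RCell of nat & seq nexp
| RAdd of rexp & rexp
| RSub of rexp & rexp
| RMul of rexp & rexp
| RDiv of rexp & rexp.

Inductive bexp : Type :=
| NLe of nexp & nexp
| RLe of rexp & rexp.

Inductive cmd : Type :=
| Skip
| NSet of nat & seq nexp & nexp
| RSet of nat & seq nexp & rexp
| Seq of cmd & cmd
| If of bexp & cmd & cmd
| For of nat & nexp & cmd.

Fixpoint ncost (e : nexp) : nat :=
  match e with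
  | NConst _ => 1
  | NCell _ es => (1 + sumn (map ncost es))%N
  | NAdd e1 e2 | NSub e1 e2 => (1 + ncost e1 + ncost e2)%N
  end.

Fixpoint rcost (e : rexp) : nat :=
  match e with
  | RNat e => (1 + ncost e)%N
  | RCell _ es => (1 + sumn (map ncost es))%N
  | RAdd e1 e2 | RSub e1 e2 | RMul e1 e2 | RDiv e1 e2 =>
      (1 + rcost e1 + rcost e2)%N
  end.

Definition bcost (b : bexp) : nat :=
  match b with
  | NLe e1 e2 => (1 + ncost e1 + ncost e2)%N
  | RLe e1 e2 => (1 + rcost e1 + rcost e2)%N
  end.

Section RealRAM.
Context {R : realType}.

Record state := State {
  nmem : nat -> seq nat -> nat;
  rmem : nat -> seq nat -> R
}.

Definition nwrite (s : state) (a : nat) (js : seq nat) (v : nat) : state :=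
  State (fun b ks => if (b == a) && (ks == js) then v else nmem s b ks) (rmem s).

Definition rwrite (s : state) (a : nat) (js : seq nat) (v : R) : state :=
  State (nmem s) (fun b ks => if (b == a) && (ks == js) then v else rmem s b ks).

Fixpoint neval (s : state) (e : nexp) : nat :=
  match e with
  | NConst n => n
  | NCell a es => nmem s a (map (neval s) es)
  | NAdd e1 e2 => (neval s e1 + neval s e2)%N
  | NSub e1 e2 => (neval s e1 - neval s e2)%N
  end.

Fixpoint reval (s : state) (e : rexp) : R :=
  match e with
  | RNat e => (neval s e)%:R
  | RCell a es => rmem s a (map (neval s) es)
  | RAdd e1 e2 => reval s e1 + reval s e2
  | RSub e1 e2 => reval s e1 - reval s e2
  | RMul e1 e2 => reval s e1 * reval s e2
  | RDiv e1 e2 => reval s e1 / reval s e2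
  end.

Definition beval (s : state) (b : bexp) : bool :=
  match b with
  | NLe e1 e2 => (neval s e1 <= neval s e2)%N
  | RLe e1 e2 => reval s e1 <= reval s e2
  end.

(* Final state and number of elementary steps. *)
Fixpoint exec (c : cmd) (s : state) : state * nat :=
  match c with
  | Skip => (s, 1%N)
  | NSet a es e =>
      (nwrite s a (map (neval s) es) (neval s e),
       (1 + sumn (map ncost es) + ncost e)%N)
  | RSet a es e =>
      (rwrite s a (map (neval s) es) (reval s e),
       (1 + sumn (map ncost es) + rcost e)%N)
  | Seq c1 c2 =>
      let r1 := exec c1 s in
      let r2 := exec c2 r1.1 in
      (r2.1, (r1.2 + r2.2)%N)
  | If b c1 c2 =>
      let r := if beval s b then exec c1 s else exec c2 s in
      (r.1, (1 + bcost b + r.2)%N)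
  | For v e c =>
      iteri (neval s e)
        (fun i acc =>
           let r := exec c (nwrite acc.1 v [::] i) in
           (r.1, (acc.2 + 1 + r.2)%N))
        (s, (1 + ncost e)%N)
  end.

(* Input of a round: integer cells 0, 1, 2 hold T, d and the index of the round
   (from 0); integer arrays 3 and 4 hold the past outcomes and the indices of
   the past predictions; real array 0 holds the contexts.  All other cells are
   0. *)
Definition input (T d N : nat) (xs : seq 'rV[R]_d) (ys : seq bool)
    (ps : seq 'I_N.+1) : state :=
  State
    (fun a js => match a, js with
     | 0, [::] => T
     | 1, [::] => d
     | 2, [::] => size ys
     | 3, [:: s] => nth false ys s
     | 4, [:: s] => nth 0 (map val ps) s
     | _, _ => 0
     end%N)
    (fun a js => match a, js with
     | 0%N, [:: s; j] => if insub j is Some i then nth 0 xs s 0 i else 0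
     | _, _ => 0
     end).

End RealRAM.

(* One real RAM program, the same for all T and d, maps the history of any
   round to N (integer cell 5) and to the N+1 weights of the distribution of
   the prediction (real array 1), in time polynomial in T and d.  The summand
   (grid (A T d)).+1 accounts for drawing the prediction from these weights.
   This is a bound per round; over the T rounds the time is at most T times
   larger. *)
Definition efficient {R : realType} (A : forall T d : nat, forecaster R d) :
    Prop :=
  exists (prog : cmd) (c k : nat),
  forall (T d : nat), (2 <= T)%N -> (1 <= d)%N ->
  forall (xs : seq 'rV[R]_d) (ys : seq bool) (ps : seq 'I_(grid (A T d)).+1),
    (size ys < T)%N -> size xs = (size ys).+1 -> size ps = size ys ->
    (forall x, x \in xs -> context_space x) ->
    let r := exec prog (input T xs ys ps) in
    [/\ (r.2 + (grid (A T d)).+1 <= c * (T + d) ^ k)%N,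
        nmem r.1 5 [::] = grid (A T d)
      & forall i : 'I_(grid (A T d)).+1,
          rmem r.1 1 [:: val i] = law xs ys ps i].

(* Main.v *)
(** For each grid point [i / N], with [N] about [T^(1/3)], an online gradient
learner of step [1 / N] runs on the rounds where [i / N] was predicted and
suggests a value [g_i = clip <theta_i, x_t>] in [[-1, 1]]; its regret against
every [u] with [|<u, x>| <= 1] on the contexts is at most
[N |u|^2 / 2 + n_i / (2 N)], and [|u|^2 <= 20] for members of [Flin1].
Randomizing over two adjacent grid points at which [g] changes sign makes the
expectation of [g_p (y - p)] at most [1 / N], whatever the outcome [y].
Summing over the grid, the swap multicalibration error is at most
[sum_t g_{p_t} (y_t - p_t) + T / (2 N) + 10 N (N + 1)], where the first sum has
mean at most [T / N] and deviates from it by [O(sqrt (T log (1 / delta)))].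
This gives [O(T^(2/3))] without any dependence on [d].  The deviation term
is small enough as long as [d log T <= T] and [log (1 / delta) <= T], and
otherwise the bound [T] on the error suffices. *)

Require Import Defs.
From HB Require Import structures.
From mathcomp Require Import all_boot all_order all_algebra.
From mathcomp Require Import all_classical all_reals all_analysis.
From mathcomp Require Import zify ring lra.

Set Implicit Arguments.
Unset Strict Implicit.
Unset Printing Implicit Defensive.

Import Order.TTheory GRing.Theory Num.Theory.

Local Open Scope ring_scope.

(** * Gradient learners, one per level, and randomization between levels *)

Section Learner.
Context {R : realType}.
Variables (N d : nat).

Definition dotn (u v : nat -> R) : R := \sum_(j < d) u j * v j.

Definition residual (b : bool) (i : nat) : R := b%:R - i%:R / N%:R.

Definition clip (a : R) : R :=
  if 1 <= a then 1 else if a <= - 1 then - 1 else a.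

(* Skipping the update when the play is already clipped in the direction of the
   outcome makes clipping free in the regret; projecting [theta] on a ball
   instead would take square roots, which the real RAM lacks. *)
Definition step (g c : R) : R :=
  if (1 <= g * g) && (0 <= g * c) then 0 else c / N%:R.

Section History.
Variables (x : nat -> nat -> R) (y : nat -> bool) (p : nat -> nat).

(** [theta s i] is the vector of the learner of level [i] after [s] rounds; only the learner of the
    predicted level moves. Histories are total functions on [nat], like the arrays of the real
    RAM. *)
Fixpoint theta (s : nat) : nat -> nat -> R :=
  if s is s'.+1 then fun i j =>
    theta s' i j +
    (i == p s')%:R *
      (step (dotn (theta s' i) (x s')) (residual (y s') i) * x s' j)
  else fun _ _ => 0.

Definition play (t i : nat) : R := clip (dotn (theta t i) (x t)).

End History.

(** The value is [n] if [g] is positive at all indices below [n]. The iteration is the loop that the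
    program runs. *)
Definition first_nonpos (g : nat -> R) (n : nat) : nat :=
  iter n (fun k => if g k <= 0 then k else k.+1) 0%N.

(* The two weights make the [g]-values of the neighbours [k.-1] and [k], of
   opposite signs, cancel in expectation. *)
Definition weight (g : nat -> R) (i : nat) : R :=
  let k := first_nonpos g N in
  if (k == 0)%N || (0 <= g k) then (i == k)%:R
  else (i == k)%:R * (g k.-1 / (g k.-1 - g k)) +
       (i == k.-1)%:R * (- g k / (g k.-1 - g k)).

End Learner.

(** Iterated from 1, this reaches the integer cube root of [T >= 1] without root extraction or
    rounding. *)
Definition grid_step (T n : nat) : nat :=
  if (n.+1 * n.+1 * n.+1 <= T)%N then n.+1 else n.

Definition grid_size (T : nat) : nat := iter T (grid_step T) 1%N.

(** * Hoare rules with a time budget for the real RAM *)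

Arguments nwrite : simpl never.
Arguments rwrite : simpl never.

Section HoareLogic.
Context {R : realType}.
Implicit Types (s : state (R := R)) (c : cmd) (Q : state (R := R) -> Prop).

(** One predicate carries both correctness and running time, so that a single pass over the program
    proves both. *)
Definition wp c s (K : nat) Q : Prop :=
  Q (exec c s).1 /\ ((exec c s).2 <= K)%N.

Lemma wp_weaken c s K K' Q : wp c s K' Q -> (K' <= K)%N -> wp c s K Q.
Proof. by move=> [HQ HK] KK; split=> //; exact: leq_trans HK KK. Qed.

Lemma wp_skip s K Q : Q s -> wp Skip s K.+1 Q.
Proof. by []. Qed.

Lemma wp_nset a es e s Q :
  Q (nwrite s a (map (neval s) es) (neval s e)) ->
  wp (NSet a es e) s (1 + sumn (map ncost es) + ncost e) Q.
Proof. by []. Qed.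

Lemma wp_rset a es e s Q :
  Q (rwrite s a (map (neval s) es) (reval s e)) ->
  wp (RSet a es e) s (1 + sumn (map ncost es) + rcost e) Q.
Proof. by []. Qed.

Lemma wp_seq c1 c2 s K1 K2 Q :
  wp c1 s K1 (fun s' => wp c2 s' K2 Q) -> wp (Seq c1 c2) s (K1 + K2) Q.
Proof. by move=> [[HQ H2] H1]; split=> //=; exact: leq_add. Qed.

Lemma wp_if b c1 c2 s K Q :
  (beval s b -> wp c1 s K Q) -> (~~ beval s b -> wp c2 s K Q) ->
  wp (If b c1 c2) s (1 + bcost b + K) Q.
Proof.
rewrite /wp /=; case: (beval s b) => H1 H2.
  by have [// HQ HK] := H1 isT; split=> //; rewrite leq_add2l.
by have [// HQ HK] := H2 isT; split=> //; rewrite leq_add2l.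
Qed.

(** [I i] describes the state before the counter is set to [i]; [K] bounds the cost of the body in
    every iteration. *)
Lemma wp_for (I : nat -> state -> Prop) v e c s n K Q :
  neval s e = n -> I 0%N s ->
  (forall i s', (i < n)%N -> I i s' -> wp c (nwrite s' v [::] i) K (I i.+1)) ->
  (forall s', I n s' -> Q s') ->
  wp (For v e c) s (1 + ncost e + n * (1 + K)) Q.
Proof.
move=> en I0 IS IQ; rewrite /wp /= en.
set f := fun i acc => _.
suff H m : (m <= n)%N ->
    I m (iteri m f (s, (1 + ncost e)%N)).1 /\
    ((iteri m f (s, (1 + ncost e)%N)).2 <= 1 + ncost e + m * (1 + K))%N.
  by have [HI HK] := H n (leqnn n); split; first exact: IQ.
elim: m => [_|m IH mn] /=; first by rewrite mul0n addn0.
have [HI HK] := IH (ltnW mn).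
have [HI' HK'] := IS _ _ mn HI.
by split=> //=; rewrite mulSn; lia.
Qed.

End HoareLogic.

(** * The forecaster as a real RAM program *)

(* Working memory, besides the input and output cells: integer cells 6 and 7 are
   loop counters and 8 holds [first_nonpos]; real arrays 2 and 4 hold [theta]
   and the plays, and real cells 3, 5 and 6 hold [g], [c] and [step g c]. *)
Local Notation nvar a := (NCell a [::]) (only parsing).
Local Notation rvar a := (RCell a [::]) (only parsing).

Definition grid_prog : cmd :=
  let n1 := RNat (NAdd (nvar 5) (NConst 1)) in
  Seq (NSet 5 [::] (NConst 1))
      (For 6 (nvar 0)
        (If (RLe (RMul (RMul n1 n1) n1) (RNat (nvar 0)))
           (NSet 5 [::] (NAdd (nvar 5) (NConst 1))) Skip)).

Definition dot_prog (out : nat) (js : seq nexp) (i s : nexp) : cmd :=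
  Seq (RSet out js (RNat (NConst 0)))
      (For 7 (nvar 1)
         (RSet out js
            (RAdd (RCell out js)
               (RMul (RCell 2 [:: i; nvar 7]) (RCell 0 [:: s; nvar 7]))))).

(** Only the history survives from one round to the next, so each round recomputes [theta] from the
    start. The nested tests stand for the conjunction in [step]. *)
Definition replay_prog : cmd :=
  let i := NCell 4 [:: nvar 6] in
  For 6 (nvar 2)
    (Seq (dot_prog 3 [::] i (nvar 6))
    (Seq (RSet 5 [::] (RSub (RNat (NCell 3 [:: nvar 6]))
                            (RDiv (RNat i) (RNat (nvar 5)))))
    (Seq (RSet 6 [::] (RDiv (rvar 5) (RNat (nvar 5))))
    (Seq (If (RLe (RNat (NConst 1)) (RMul (rvar 3) (rvar 3)))
           (If (RLe (RNat (NConst 0)) (RMul (rvar 3) (rvar 5)))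
              (RSet 6 [::] (RNat (NConst 0))) Skip) Skip)
         (For 7 (nvar 1)
           (RSet 2 [:: i; nvar 7]
              (RAdd (RCell 2 [:: i; nvar 7])
                 (RMul (rvar 6) (RCell 0 [:: nvar 6; nvar 7]))))))))).

Definition play_prog : cmd :=
  let g := RCell 4 [:: nvar 6] in
  let m1 := RSub (RNat (NConst 0)) (RNat (NConst 1)) in
  For 6 (NAdd (nvar 5) (NConst 1))
    (Seq (dot_prog 4 [:: nvar 6] (nvar 6) (nvar 2))
         (If (RLe (RNat (NConst 1)) g) (RSet 4 [:: nvar 6] (RNat (NConst 1)))
            (If (RLe g m1) (RSet 4 [:: nvar 6] m1) Skip))).

(** Array 1 is initially zero, so only the one or two nonzero weights are written. *)
Definition weight_prog : cmd :=
  let k := nvar 8 in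
  let k1 := NSub (nvar 8) (NConst 1) in
  let g := RCell 4 [:: k] in
  let g1 := RCell 4 [:: k1] in
  let z := RNat (NConst 0) in
  let one := RSet 1 [:: k] (RNat (NConst 1)) in
  Seq (For 6 (nvar 5)
         (If (RLe g z) Skip (NSet 8 [::] (NAdd (nvar 8) (NConst 1)))))
      (If (NLe k (NConst 0)) one
      (If (RLe z g) one
         (Seq (RSet 1 [:: k] (RDiv g1 (RSub g1 g)))
              (RSet 1 [:: k1] (RDiv (RSub z g) (RSub g1 g)))))).

Definition main_prog : cmd :=
  Seq grid_prog (Seq replay_prog (Seq play_prog weight_prog)).

(** * Correctness and cost of the program *)

Section Correctness.
Context {R : realType}.
Variables (T d t : nat) (x : nat -> nat -> R) (y : nat -> bool) (p : nat -> nat).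

Let N := grid_size T.

Definition env (s : state (R := R)) : Prop :=
  [/\ nmem s 0 [::] = T, nmem s 1 [::] = d & nmem s 2 [::] = t] /\
  [/\ forall r, nmem s 3 [:: r] = y r, forall r, nmem s 4 [:: r] = p r
    & forall r j, rmem s 0 [:: r; j] = x r j].

(** The numerals in the cost bounds are generous: only polynomial growth matters. *)
Lemma grid_progP s (Q : state (R := R) -> Prop) :
  env s ->
  (forall s' : state (R := R), env s' -> nmem s' 5 [::] = N -> nmem s' 8 = nmem s 8 ->
     rmem s' = rmem s -> Q s') ->
  wp grid_prog s (5 + T * 31) Q.
Proof.
move=> es HQ; apply: wp_weaken.
  apply: wp_seq; apply: wp_nset.
  apply: (wp_for (K := 30) (n := T) (I := fun n s' =>
    [/\ env s', nmem s' 5 [::] = iter n (grid_step T) 1%N,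
        nmem s' 8 = nmem s 8 & rmem s' = rmem s])).
  - by case: es => -[].
  - by split.
  - move=> i s' iT [es' h5 h8 hr]; apply: wp_weaken.
      have [[hT _ _] _] := es'.
      apply: (wp_if (K := 4)) => hle;
        rewrite /nwrite /= h5 hT -!natrM ler_nat addn1 in hle.
        apply: wp_nset; split=> //.
        by rewrite /nwrite /= h5 [in RHS]/grid_step hle addn1.
      apply: wp_skip; split=> //.
      by rewrite /nwrite /= h5 [in RHS]/grid_step (negbTE hle).
    by [].
  by move=> s' [*]; apply: HQ.
by rewrite /=; lia.
Qed.

(** The hypothesis on [js], [i] and [r] makes these expressions independent of the loop counter,
    cell 7. The bound [2 < a] keeps the accumulator off the arrays 0 and 2 being read and off the
    output array 1. *)
Lemma dot_progP s a js i r ks (iv rv : nat) (Q : state (R := R) -> Prop) :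
  (2 < a)%N -> nmem s 1 [::] = d ->
  (sumn (map ncost js) <= 10)%N -> (ncost i <= 10)%N -> (ncost r <= 10)%N ->
  (forall s' : state (R := R), (forall b ls, b != 7 -> nmem s' b ls = nmem s b ls) ->
     [/\ map (neval s') js = ks, neval s' i = iv & neval s' r = rv]) ->
  (forall s' : state (R := R), (forall b ls, b != 7 -> nmem s' b ls = nmem s b ls) ->
     (forall b ls, (b == a) && (ls == ks) = false ->
        rmem s' b ls = rmem s b ls) ->
     rmem s' a ks = dotn d (fun j => rmem s 2 [:: iv; j])
                           (fun j => rmem s 0 [:: rv; j]) -> Q s') ->
  wp (dot_prog a js i r) s (20 + d * 70) Q.
Proof.
move=> a2 hd cjs ci cr hev HQ; apply: wp_weaken.
  apply: wp_seq; apply: wp_rset.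
  apply: (wp_for (K := 60) (n := d) (I := fun n s' =>
    [/\ forall b ls, b != 7 -> nmem s' b ls = nmem s b ls,
        forall b ls, (b == a) && (ls == ks) = false ->
          rmem s' b ls = rmem s b ls
      & rmem s' a ks = dotn n (fun j => rmem s 2 [:: iv; j])
                           (fun j => rmem s 0 [:: rv; j])])) => //.
  - have [-> _ _] := hev s (fun _ _ _ => erefl).
    split=> //= [b ls|]; first by rewrite /rwrite /= => ->.
    by rewrite /rwrite /= !eqxx /dotn big_ord0.
  - move=> j s' jd [hn hr hdot].
    set s1 := nwrite s' 7 [::] j.
    have hn1 b ls : b != 7 -> nmem s1 b ls = nmem s b ls.
      by move=> b7; rewrite /s1 /nwrite /= (negbTE b7) hn.
    have [ejs ei er] := hev s1 hn1.
    apply: wp_weaken; first apply: wp_rset.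
      rewrite /= ejs ei er; split=> //= [b ls hb|].
        by rewrite /rwrite /= hb hr.
      rewrite /rwrite /= !eqxx /= /dotn big_ord_recr /=.
      have na b : (b < 3)%N -> (b == a) = false by move=> b3; apply/eqP; lia.
      by congr (_ + _ * _); rewrite /s1 /nwrite /= ?hdot // hr // na.
    by rewrite /=; lia.
  - by move=> s' [*]; apply: HQ.
by rewrite /=; lia.
Qed.

(** The state once the grid size is known: the counter for [first_nonpos] and the output weights
    still have their initial value 0. *)
Definition ready (s : state (R := R)) : Prop :=
  env s /\
  [/\ nmem s 5 [::] = N, nmem s 8 [::] = 0%N & forall ls, rmem s 1 ls = 0].

Lemma ready_frame s s' :
  (forall b ls, (b != 6) && (b != 7) -> nmem s' b ls = nmem s b ls) ->
  (forall b ls, (b < 2)%N -> rmem s' b ls = rmem s b ls) ->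
  ready s -> ready s'.
Proof.
move=> hn hr [[[h0 h1 h2] [h3 h4 h5]] [h6 h7 h8]].
split; [split; split|split] => *; rewrite ?hn ?hr //.
Qed.

Lemma replay_progP s (Q : state (R := R) -> Prop) :
  ready s -> (forall ls, rmem s 2 ls = 0) ->
  (forall s' : state (R := R), ready s' ->
     (forall i j, (j < d)%N -> rmem s' 2 [:: i; j] = theta N d x y p t i j) ->
     Q s') ->
  wp replay_prog s (4 + t * (200 + d * 140)) Q.
Proof.
move=> rs z2 HQ; apply: wp_weaken.
  apply: (wp_for (K := 180 + d * 140) (n := t) (I := fun n s' => ready s' /\
    forall i j, (j < d)%N -> rmem s' 2 [:: i; j] = theta N d x y p n i j)).
  - by case: rs => -[[]].
  - by split=> // i j _; rewrite z2.
  - move=> r s0 rt [rs0 th0]; set s1 := nwrite _ _ _ _.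
    have rs1 : ready s1 by exact: rs0.
    have th1 : forall i j, (j < d)%N ->
      rmem s1 2 [:: i; j] = theta N d x y p r i j by [].
    have r1 : nmem s1 6 [::] = r by [].
    move: s1 rs1 th1 r1 => s1 rs1 th1 r1.
    have [[[_ hd _] [h3 h4 hx]] [h5 _ _]] := rs1.
    pose g := dotn d (theta N d x y p r (p r)) (x r).
    pose c : R := residual N (y r) (p r).
    apply: wp_weaken; first apply: wp_seq.
      apply: (dot_progP (ks := [::]) (iv := p r) (rv := r)) => //.
        by move=> s' hn; split=> //=; rewrite !hn // r1 // h4.
      move=> s2 hn hr hg.
      have {}hg : rmem s2 3 [::] = g.
        by rewrite hg; apply: eq_bigr => j _ /=; rewrite th1 // hx.
      have rs2 : ready s2.
        apply: ready_frame rs1 => [b ls /andP[_ b7]|b ls b2]; first by rewrite hn.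
        by rewrite hr //; case: eqP => // e; move: b2; rewrite e.
      have th2 i j : (j < d)%N -> rmem s2 2 [:: i; j] = theta N d x y p r i j.
        by move=> jd; rewrite hr // th1.
      have r2 : nmem s2 6 [::] = r by rewrite hn.
      move: s2 {hn hr} rs2 th2 r2 hg => s2 rs2 th2 r2 hg.
      have [[_ [k3 k4 kx]] [k5 _ _]] := rs2.
      apply: wp_seq; apply: wp_rset.
      rewrite /= r2 k3 k4 k5 -/(residual N (y r) (p r)) -/c.
      apply: wp_seq; apply: wp_rset.
      set s3 := rwrite _ _ _ _.
      have rs3 : ready s3 by exact: rs2.
      apply: wp_seq.
      pose Q5 (s' : state (R := R)) := [/\ ready s', nmem s' 6 [::] = r,
        forall i j, (j < d)%N -> rmem s' 2 [:: i; j] = theta N d x y p r i j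
        & rmem s' 6 [::] = step N g c].
      have e6 : rmem s3 6 [::] = c / N%:R by rewrite /s3 /rwrite /= k5.
      have e5 : rmem s3 5 [::] = c by [].
      have e3 : rmem s3 3 [::] = g by [].
      have r3 : nmem s3 6 [::] = r by [].
      have th3 i j : (j < d)%N -> rmem s3 2 [:: i; j] = theta N d x y p r i j.
        exact: th2.
      clearbody s3.
      have H5 : wp (If (RLe (RNat (NConst 1)) (RMul (rvar 3) (rvar 3)))
           (If (RLe (RNat (NConst 0)) (RMul (rvar 3) (rvar 5)))
              (RSet 6 [::] (RNat (NConst 0))) Skip) Skip) s3 30 Q5.
        have Z : 1 <= g * g -> 0 <= g * c -> Q5 (rwrite s3 6 [::] 0).
          by move=> h1 h2; split=> //; rewrite /rwrite /step h1 h2.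
        have NZ : ~~ ((1 <= g * g) && (0 <= g * c)) -> Q5 s3.
          by move=> h; split=> //; rewrite e6 /step (negbTE h).
        apply: wp_weaken.
          apply: (wp_if (K := 20)) => /=; rewrite e3 => h1.
            apply: wp_weaken; first apply: (wp_if (K := 5)).
            - rewrite /= e3 e5 => h2; apply: wp_weaken; first by apply: wp_rset; exact: Z.
              by [].
            - rewrite /= e3 e5 => h2; apply: wp_skip; apply: NZ.
              by rewrite (negbTE h2) andbF.
            by [].
          by apply: wp_skip; apply: NZ; rewrite (negbTE h1).
        by [].
      have [H5Q H5K] := H5; split; last exact: H5K.
      move: H5Q; move: (exec _ s3).1 => s5 [rs5 r5 th5 e65].
      (* After [n] iterations, row [p r] carries the update in its first [n] coordinates only. *)
      apply: (wp_for (K := 60) (n := d) (I := fun n s' =>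
        [/\ ready s', nmem s' 6 [::] = r, rmem s' 6 [::] = step N g c
          & forall i j, (j < d)%N -> rmem s' 2 [:: i; j] =
              theta N d x y p r i j +
              ((i == p r) && (j < n)%N)%:R * (step N g c * x r j)])).
      - by case: rs5 => -[[]].
      - by split=> // i j jd; rewrite th5 // ltn0 andbF mul0r addr0.
      - move=> j s6 jd [rs6 r6 e66 th6].
        have [[_ [l3 l4 lx]] _] := rs6.
        apply: wp_weaken; first apply: wp_rset.
          rewrite /= /nwrite /= r6 l4 e66 lx.
          split=> //.
          move=> i j' jd'; rewrite /rwrite /=.
          case: ifP => [/eqP[-> ->]|].
            by rewrite th6 // eqxx ltnn ltnSn /= mul0r addr0 mul1r.
          rewrite th6 // !eqseq_cons andbT => hij; congr (_ + _ * _).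
          rewrite [in RHS]ltnS [in RHS]leq_eqVlt.
          by move: hij; case: (i == p r) => //= ->.
        by [].
      move=> s7 [rs7 _ _ th7]; split=> // i j jd.
      rewrite th7 // jd andbT /=; congr (_ + _).
      by case: eqP => [->|_]; rewrite ?mul1r ?mul0r.
    by rewrite /=; lia.
  by move=> s' [*]; apply: HQ.
by rewrite /=; lia.
Qed.

Let g := play N d x y p t.

Lemma play_progP s (Q : state (R := R) -> Prop) :
  ready s ->
  (forall i j, (j < d)%N -> rmem s 2 [:: i; j] = theta N d x y p t i j) ->
  (forall s' : state (R := R), ready s' ->
     (forall i, (i <= N)%N -> rmem s' 4 [:: i] = g i) -> Q s') ->
  wp play_prog s (8 + N.+1 * (100 + d * 70)) Q.
Proof.
move=> rs th HQ; apply: wp_weaken.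
  apply: (wp_for (K := 80 + d * 70) (n := N.+1) (I := fun n s' =>
    [/\ ready s',
       forall i j, (j < d)%N -> rmem s' 2 [:: i; j] = theta N d x y p t i j
     & forall i, (i < n)%N -> rmem s' 4 [:: i] = g i])).
  - by case: rs => _ [/= -> _ _]; rewrite addn1.
  - by [].
  - move=> i s0 iN [rs0 th0 g0]; set s1 := nwrite _ _ _ _.
    have rs1 : ready s1 by [].
    have th1 : forall i j, (j < d)%N ->
      rmem s1 2 [:: i; j] = theta N d x y p t i j by [].
    have g1 : forall i', (i' < i)%N -> rmem s1 4 [:: i'] = g i' by [].
    have i1 : nmem s1 6 [::] = i by [].
    clearbody s1; have [[[_ hd ht] [_ _ hx]] _] := rs1.
    apply: wp_weaken; first apply: wp_seq.
      apply: (dot_progP (ks := [:: i]) (iv := i) (rv := t)) => //.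
        by move=> s' hn; split=> //=; rewrite !hn // i1.
      move=> s2 hn hr hg.
      have {}hg : rmem s2 4 [:: i] = dotn d (theta N d x y p t i) (x t).
        by rewrite hg; apply: eq_bigr => j _ /=; rewrite th1 // hx.
      have rs2 : ready s2.
        apply: ready_frame rs1 => [b ls /andP[_ b7]|b ls b2]; first by rewrite hn.
        by rewrite hr //; case: eqP => // e; move: b2; rewrite e.
      have th2 i' j : (j < d)%N ->
          rmem s2 2 [:: i'; j] = theta N d x y p t i' j.
        by move=> jd; rewrite hr // th1.
      have i2 : nmem s2 6 [::] = i by rewrite hn.
      have g2 i' : (i' < i)%N -> rmem s2 4 [:: i'] = g i'.
        move=> lt; rewrite hr ?g1 // !eqseq_cons andbT.
        by rewrite (ltn_eqF lt) andbF.
      have HS v : v = g i -> forall i', (i' < i.+1)%N ->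
          rmem (rwrite s2 4 [:: i] v) 4 [:: i'] = g i'.
        move=> -> i' ; rewrite ltnS leq_eqVlt /rwrite /= eqseq_cons andbT.
        by case: eqP => [->//|_ /=]; exact: g2.
      apply: (wp_weaken (K' := 50)); last by [].
      apply: wp_weaken; first apply: (wp_if (K := 30)).
      - rewrite /= i2 hg => h1; apply: wp_weaken; first apply: wp_rset.
          by rewrite /= i2; split=> //; apply: HS; rewrite /g /play /clip h1.
        by [].
      - rewrite /= i2 hg => h1; apply: wp_weaken.
          apply: (wp_if (K := 15)).
          + rewrite /= i2 hg => h2; apply: wp_weaken; first apply: wp_rset.
              rewrite /= i2; split=> //; apply: HS.
              by move: h2; rewrite sub0r /g /play /clip (negbTE h1) => ->.
            by [].
          + rewrite /= i2 hg sub0r => h2; apply: wp_skip; split=> // i'.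
            rewrite ltnS leq_eqVlt => /orP[/eqP ->|]; last exact: g2.
            by rewrite hg /g /play /clip (negbTE h1) (negbTE h2).
          by [].
        by [].
    by rewrite /=; lia.
  - move=> s' [rs' _ hg]; by apply: HQ.
by rewrite /=; lia.
Qed.

Lemma first_nonpos_le (h : nat -> R) n : (first_nonpos h n <= n)%N.
Proof.
by elim: n => //= n IH; case: ifP => _ //; exact: leq_trans IH _.
Qed.

Lemma weight_progP s (Q : state (R := R) -> Prop) :
  ready s -> (forall i, (i <= N)%N -> rmem s 4 [:: i] = g i) ->
  (forall s' : state (R := R), nmem s' 5 [::] = N ->
     (forall i, rmem s' 1 [:: i] = weight N g i) -> Q s') ->
  wp weight_prog s (100 + N * 20) Q.
Proof.
move=> rs hg HQ; apply: wp_weaken.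
  apply: wp_seq.
  apply: (wp_for (K := 18) (n := N) (I := fun n s' =>
    [/\ nmem s' 5 [::] = N, nmem s' 8 [::] = first_nonpos g n,
        forall ls, rmem s' 1 ls = 0
      & forall i, (i <= N)%N -> rmem s' 4 [:: i] = g i])).
  - by case: rs => _ [].
  - by case: rs => _ [].
  - move=> i s' iN [h5 h8 h1 h4].
    have kN : (first_nonpos g i <= N)%N.
      by rewrite (leq_trans (first_nonpos_le g i)) // ltnW.
    apply: wp_weaken; first apply: (wp_if (K := 4)).
    - rewrite /nwrite /= h8 h4 // => hle.
      by apply: wp_skip; split=> //; rewrite /= h8 hle.
    - rewrite /nwrite /= h8 h4 // => hle.
      apply: wp_nset; split=> //.
      by rewrite /nwrite /= h8 (negbTE hle) addn1.
    by [].
  - move=> s' [h5 h8 h1 h4].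
    have kN := first_nonpos_le g N.
    have k1N : ((first_nonpos g N).-1 <= N)%N by lia.
    have one : (first_nonpos g N == 0)%N || (0 <= g (first_nonpos g N)) ->
        wp (RSet 1 [:: nvar 8] (RNat (NConst 1))) s' 50 Q.
      move=> hw; apply: wp_weaken; first apply: wp_rset.
        apply: HQ => // i.
        rewrite /rwrite /= h8 /weight hw eqseq_cons andbT.
        by case: eqP => //; rewrite h1.
      by [].
    apply: (wp_weaken (K' := 80)); last by [].
    apply: wp_weaken; first apply: (wp_if (K := 70)).
    - rewrite /= h8 leqn0 => hk; apply: wp_weaken; first by apply: one; rewrite hk.
      by [].
    - rewrite /= h8 leqn0 => hk; apply: wp_weaken; first apply: (wp_if (K := 50)).
      + by rewrite /= h8 h4 // => hw; apply: one; rewrite hw orbT.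
      + rewrite /= h8 h4 // => hw; apply: wp_weaken.
          apply: wp_seq; apply: wp_rset; apply: wp_rset.
          apply: HQ => // i; rewrite /rwrite /= h8 subn1 !h4 //.
          rewrite /weight (negbTE hk) (negbTE hw) /= !eqseq_cons !andbT sub0r h1.
          (* The index is positive here, so the two writes go to distinct cells. *)
          have kk : (first_nonpos g N).-1 != first_nonpos g N.
            by apply/eqP; move/eqP: hk; lia.
          case: (eqVneq i (first_nonpos g N).-1) => [->|_].
            by rewrite (negbTE kk) mul0r add0r mul1r.
          by case: eqP => _; rewrite ?mul1r ?mul0r ?addr0.
        by [].
      by [].
    by [].
by rewrite /=; lia.
Qed.

(** The subtracted [N.+1] leaves room for the cost of drawing the prediction, which [efficient] adds
    to the running time. *)
Lemma main_progP s :
  (t < T)%N -> (N <= T)%N -> env s -> nmem s 8 [::] = 0%N ->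
  (forall ls, rmem s 1 ls = 0) -> (forall ls, rmem s 2 ls = 0) ->
  wp main_prog s (1000 * (T + d).+1 ^ 2 - N.+1) (fun s' : state (R := R) =>
    nmem s' 5 [::] = N /\ forall i, rmem s' 1 [:: i] = weight N g i).
Proof.
move=> tT NT es h8 h1 h2; apply: wp_weaken.
  apply: wp_seq; apply: grid_progP => // s1 es1 N1 k1 m1.
  have rs1 : ready s1 by split=> //; rewrite k1 m1.
  apply: wp_seq; apply: replay_progP => // [|s2 rs2 th2].
    by move=> ls; rewrite m1.
  apply: wp_seq; apply: play_progP => // s3 rs3 g3.
  by apply: weight_progP.
by nia.
Qed.

End Correctness.

(** * The grid size as an integer cube root *)

Section GridSize.
Variable T : nat.

Lemma grid_size_gt0 : (0 < grid_size T)%N.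
Proof.
rewrite /grid_size; elim: {1}T => // n IH; rewrite iterS.
by set m := iter n _ _ in IH *; rewrite /grid_step; case: ifP.
Qed.

Lemma grid_size_cube_le :
  (0 < T)%N -> (grid_size T * grid_size T * grid_size T <= T)%N.
Proof.
(* The induction runs over the iteration count; the threshold [T] inside [grid_step] stays fixed. *)
move=> T0; rewrite /grid_size; elim: {1 3 5}T => // n IH; rewrite iterS.
by set m := iter n _ _ in IH *; rewrite /grid_step; case: ifP.
Qed.

Lemma grid_size_le : (0 < T)%N -> (grid_size T <= T)%N.
Proof. by move=> /grid_size_cube_le; have := grid_size_gt0; nia. Qed.

(** Either the counter has stopped, because the next cube exceeds [T], or it has advanced at every
    iteration and exceeds their number. After [T] iterations both cases give the bound. *)
Lemma grid_size_cube_gt :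
  (T < (grid_size T).+1 * (grid_size T).+1 * (grid_size T).+1)%N.
Proof.
have H n : (T < (iter n (grid_step T) 1).+1 * (iter n (grid_step T) 1).+1 *
    (iter n (grid_step T) 1).+1)%N \/ (n < iter n (grid_step T) 1)%N.
  elim: n => [|n IH]; first by right.
  rewrite iterS; set m := iter n _ _ in IH *; rewrite /grid_step.
  case: ifP => [hle|/negbT]; last by rewrite -ltnNge; left.
  by case: IH => [|IH]; [lia|right].
by rewrite /grid_size; case: (H T) => // {H}; nia.
Qed.

End GridSize.

(** * Expectations under the randomized prediction *)

Section Weights.
Context {R : realType}.
Variables (N : nat) (g : nat -> R).
Let k := first_nonpos g N.

Lemma first_nonposP n :
  (forall j, (j < first_nonpos g n)%N -> 0 < g j) /\
  ((first_nonpos g n < n)%N -> g (first_nonpos g n) <= 0).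
Proof.
elim: n => [//|n [IH1 IH2]] /=; case: ifP => [//|/negbT].
rewrite -ltNge => h; split=> [j|].
  by rewrite ltnS leq_eqVlt => /orP[/eqP ->|/IH1].
rewrite ltnS => lt; have := first_nonpos_le g n => le.
by move: h; rewrite ltNge IH2.
Qed.

(** The strict signs make the denominator [g k.-1 - g k] of the mixing weights positive. *)
Lemma weight_mixed : ~~ ((k == 0)%N || (0 <= g k)) ->
  [/\ (0 < k)%N, 0 < g k.-1 & g k < 0].
Proof.
rewrite negb_or -lt0n -ltNge => /andP[k0 gk]; split=> //.
by apply: (first_nonposP N).1; rewrite ltn_predL.
Qed.

Lemma weight_ge0 i : 0 <= weight N g i.
Proof.
rewrite /weight -/k; case: ifPn => [_|/weight_mixed[_ g1 g0]]; first exact: ler0n.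
have h : 0 < g k.-1 - g k by lra.
by apply: addr_ge0; apply: mulr_ge0 => //; apply: divr_ge0; lra.
Qed.

Lemma sum_delta n m (F : nat -> R) : (m < n)%N ->
  \sum_(i < n) (i == m :> nat)%:R * F i = F m.
Proof.
move=> mn; rewrite (bigD1 (Ordinal mn)) //= eqxx mul1r big1 ?addr0 // => i ne.
by rewrite (_ : (_ == _) = false) ?mul0r //; apply: negbTE.
Qed.

Lemma sum_weight (F : nat -> R) :
  \sum_(i < N.+1) weight N g i * F i =
  if (k == 0)%N || (0 <= g k) then F k
  else F k * (g k.-1 / (g k.-1 - g k)) + F k.-1 * (- g k / (g k.-1 - g k)).
Proof.
have kN : (k < N.+1)%N by rewrite ltnS first_nonpos_le.
rewrite /weight -/k; case: ifPn => _; first exact: sum_delta.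
under eq_bigr do rewrite mulrDl -!mulrA.
rewrite big_split /=.
rewrite (sum_delta (fun i => (g k.-1 * ((g k.-1 - g k)^-1 * F i))) kN).
rewrite (sum_delta (fun i => (- g k * ((g k.-1 - g k)^-1 * F i)))); last by lia.
by ring.
Qed.

Lemma sum_weight1 : \sum_(i < N.+1) weight N g i = 1.
Proof.
under eq_bigr do rewrite -[weight _ _ _]mulr1.
rewrite (sum_weight (fun=> 1)); case: ifPn => // /weight_mixed[_ g1 g0].
by field; lra.
Qed.

(** If a single point is played, either [g k = 0], or [k = 0] with [g k < 0] and residual [b >= 0],
    or [k = N] with [g k >= 0] and residual [b - 1 <= 0]: the product is never positive. If two
    points are mixed, [g] has mean 0, so [b] cancels; the two residuals differ by [1 / N], which
    leaves [g k.-1 * q / N] with [q] the weight of [k.-1]. *)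
Lemma sum_weight_residual b : (0 < N)%N -> (forall i, `|g i| <= 1) ->
  \sum_(i < N.+1) weight N g i * (g i * residual N b i) <= N%:R^-1.
Proof.
move=> N0 g1; have Nr : 0 < N%:R :> R by rewrite ltr0n.
have iN : 0 < N%:R^-1 :> R by rewrite invr_gt0.
rewrite (sum_weight (fun i => g i * residual N b i)).
have kN := first_nonpos_le g N; rewrite -/k in kN.
case: ifPn => [|/weight_mixed[k0 hg1 hg0]].
  have [h1 h2] := first_nonposP N; rewrite -/k in h1 h2.
  have hb : 0 <= (b%:R : R) <= 1 by case: b; rewrite /= ?lexx ?ler01.
  move=> hk; apply: le_trans (ltW iN); rewrite /residual.
  have [ltkN|leNk] := ltnP k N.
    have gk := h2 ltkN.
    have [g0|] := ltP (g k) 0; last first.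
      by move=> g0; have -> : g k = 0 by lra; rewrite mul0r.
    have -> : k%:R = 0 :> R by move: hk; rewrite leNgt g0 orbF => /eqP ->.
    by rewrite mul0r subr0; nra.
  have -> : k%:R = N%:R :> R by congr _%:R; lia.
  rewrite divff ?gt_eqF //; have [g0|g0] := leP 0 (g k); first by nra.
  by move: hk; rewrite leNgt g0 orbF; lia.
have hk : k%:R = k.-1%:R + 1 :> R by rewrite natr1 prednK.
have := g1 k.-1; rewrite ler_norml => /andP[_ g11].
rewrite /residual hk.
have h : 0 < g k.-1 - g k by lra.
set q := - g k / (g k.-1 - g k).
have q1 : 0 <= q <= 1.
  by rewrite /q divr_ge0 /= ?ler_pdivrMr ?mul1r; lra.
have -> : g k * (b%:R - (k.-1%:R + 1) / N%:R) * (g k.-1 / (g k.-1 - g k)) +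
  g k.-1 * (b%:R - k.-1%:R / N%:R) * q = g k.-1 * q * N%:R^-1.
  by rewrite /q; field; apply/andP; split; lra.
by rewrite -[leRHS]mul1r ler_pM2r //; nra.
Qed.

End Weights.

(** * Exponential moments of bounded variables *)

Section Exponential.
Context {R : realType}.

(** From [expR (- z) >= 1 - z], the exponential is at most [1 / (1 - z)], and [(1 + z + 2 z^2) (1 -
    z) = 1 + z^2 (1 - 2 z) >= 1]. *)
Lemma expR_le_quadratic (z : R) : z <= 2^-1 -> expR z <= 1 + z + 2 * z ^+ 2.
Proof.
move=> hz; rewrite -[z in expR z]opprK expRN.
have h := expR_ge1Dx (- z); have h0 : 0 < 1 - z by lra.
apply: (le_trans (y := (1 - z)^-1)); first by rewrite lef_pV2 ?posrE ?expR_gt0.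
by rewrite -[_^-1]mul1r ler_pdivrMr //; nra.
Qed.

(** The quadratic bound applies pointwise because [l * X i <= 1 / 2]; after averaging,
    [1 + a <= expR a] returns to exponential form. *)
Lemma mgf_le (I : finType) (w X : I -> R) (l m : R) :
  0 <= l <= 2^-1 -> (forall i, 0 <= w i) -> \sum_i w i = 1 ->
  (forall i, `|X i| <= 1) -> \sum_i w i * X i <= m ->
  \sum_i w i * expR (l * X i) <= expR (l * m + 2 * l ^+ 2).
Proof.
move=> /andP[l0 l1] w0 w1 X1 Xm; apply: le_trans (expR_ge1Dx _).
apply: (le_trans (y := \sum_i (w i + l * (w i * X i) + w i * (2 * l ^+ 2)))).
  apply: ler_sum => i _; have := X1 i; rewrite ler_norml => /andP[X0 X2].
  apply: (le_trans (y := w i * (1 + l * X i + 2 * (l * X i) ^+ 2))).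
    apply: ler_wpM2l => //; apply: expR_le_quadratic; apply: le_trans l1.
    by rewrite -[leRHS]mulr1; apply: ler_wpM2l.
  have hX2 : (l * X i) ^+ 2 <= l ^+ 2.
    by rewrite exprMn -[leRHS]mulr1; apply: ler_wpM2l; [exact: sqr_ge0|nra].
  by have := w0 i; nra.
rewrite !big_split /= w1 -mulr_sumr -mulr_suml w1 mul1r addrA.
by rewrite lerD2r lerD2l; apply: ler_wpM2l.
Qed.

End Exponential.

(** * Sums over runs of a history-dependent process *)

Section TupleSums.
Context {R : realType} {I : finType}.
Implicit Types (G : seq I -> I -> R).

(** Conditioning on the first draw [i]: the rest is a process of the same kind, with [i] prepended
    to its history. *)
Lemma sum_tuple_prodS G n :
  \sum_(p : n.+1.-tuple I) \prod_(t < n.+1) G (take t p) (tnth p t) =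
  \sum_i G [::] i * \sum_(p : n.-tuple I)
    \prod_(t < n) G (i :: take t p) (tnth p t).
Proof.
under [RHS]eq_bigr do rewrite mulr_sumr.
rewrite pair_big /=.
rewrite (reindex (fun q : I * n.-tuple I => cons_tuple q.1 q.2)) /=; last first.
  exists (fun p : n.+1.-tuple I => (thead p, [tuple of behead p])) => [[i p]|p] _.
    by congr (_, _); apply: val_inj.
  by apply: val_inj; case/tupleP: p => i p /=; rewrite theadE.
apply: eq_bigr => -[i p] _ /=; rewrite big_ord_recl /= tnth0; congr (_ * _).
by apply: eq_bigr => t _; rewrite tnthS.
Qed.

(** Each round contributes a factor at most [K] whatever the history, so peeling off the first round
    gives the product bound by induction. *)
Lemma sum_tuple_prod_le G (K : R) n :
  (forall h i, 0 <= G h i) -> (forall h, \sum_i G h i <= K) -> 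
  \sum_(p : n.-tuple I) \prod_(t < n) G (take t p) (tnth p t) <= K ^+ n.
Proof.
move=> + HK; have K0 : (forall h i, 0 <= G h i) -> 0 <= K.
  by move=> G0; apply: le_trans (HK [::]); apply: sumr_ge0.
elim: n G HK K0 => [|n IH] G HK K0 G0.
  rewrite (eq_bigr (fun=> 1)) => [|p _]; last by rewrite big_ord0.
  by rewrite sumr_const card_tuple expn0 expr0.
rewrite sum_tuple_prodS exprS.
apply: (le_trans (y := \sum_i G [::] i * K ^+ n)).
  apply: ler_sum => i _; apply: ler_wpM2l => //.
  by apply: (IH (fun h => G (i :: h))) => // *; exact: K0.
by rewrite -mulr_suml ler_wpM2r // exprn_ge0 // K0.
Qed.

Lemma sum_tuple_prod1 G n : (forall h, \sum_i G h i = 1) ->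
  \sum_(p : n.-tuple I) \prod_(t < n) G (take t p) (tnth p t) = 1.
Proof.
elim: n G => [|n IH] G G1.
  rewrite (eq_bigr (fun=> 1)) => [|p _]; last by rewrite big_ord0.
  by rewrite sumr_const card_tuple expn0.
rewrite sum_tuple_prodS -[RHS](G1 [::]); apply: eq_bigr => i _.
by rewrite (IH (fun h => G (i :: h))) ?mulr1.
Qed.

End TupleSums.

(** * Regret of a single gradient learner *)

Section Regret.
Context {R : realType}.
Variables (N d : nat).
Hypothesis N_gt0 : (0 < N)%N.
Let N_gt0R : 0 < N%:R :> R. Proof. by rewrite ltr0n. Qed.

Lemma clip_norm_le1 (a : R) : `|clip a| <= 1.
Proof.
rewrite /clip ler_norml; case: (leP 1 a) => [_|h]; first by lra.
by case: (leP a (-1)) => [_|h']; lra.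
Qed.

Lemma residual_norm_le1 b i : (i <= N)%N -> `|residual N b i : R| <= 1.
Proof.
move=> iN; have h : 0 <= (i%:R / N%:R : R) <= 1.
  by rewrite divr_ge0 //= ler_pdivrMr // mul1r ler_nat.
by rewrite /residual ler_norml; case: b => /=; lra.
Qed.

(** Here [v = <u, x>], [g = <theta, x>], [q = |x|^2], and the second summand is the change of the
    potential [N / 2 * |u - theta|^2]. If the update is skipped, [clip g * c = |c| >= v * c].
    Otherwise [v * c] cancels against the potential, leaving [g * c + c^2 * q / (2 N)], and
    [g * c <= clip g * c]. *)
Lemma regret_step (v g c q : R) : `|v| <= 1 -> `|c| <= 1 -> 0 <= q <= 1 ->
  v * c + N%:R / 2 * (step N g c ^+ 2 * q - 2 * step N g c * (v - g)) <=
  clip g * c + N%:R^-1 / 2.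
Proof.
rewrite !ler_norml => /andP[v0 v1] /andP[c0 c1] /andP[q0 q1].
have iN : 0 < N%:R^-1 :> R by rewrite invr_gt0.
rewrite /step; case: ifPn => [/andP[h1 h2]|hns].
  rewrite expr0n /= mulr0 !mul0r subr0 mulr0 addr0.
  suff : v * c <= clip g * c by lra.
  rewrite /clip; case: (leP 1 g) => [g1|g1].
    by have c2 : 0 <= c; nra.
  case: (leP g (-1)) => g2; last first.
    have h3 : 0 < (1 - g) * (1 + g) by apply: mulr_gt0; lra.
    have : g * g < 1 by lra.
    by rewrite ltNge h1.
  by have c2 : c <= 0; nra.
have -> : N%:R / 2 * ((c / N%:R) ^+ 2 * q - 2 * (c / N%:R) * (v - g)) =
    c ^+ 2 * q * N%:R^-1 / 2 - c * (v - g) by field; rewrite gt_eqF.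
suff H : g * c <= clip g * c.
  have : c ^+ 2 * q * N%:R^-1 <= N%:R^-1.
    by rewrite -[leRHS]mul1r ler_pM2r //; nra.
  by nra.
rewrite /clip; case: (leP 1 g) => [g1|g1].
  by move: hns; rewrite negb_and -!ltNge => /orP[]; nra.
case: (leP g (-1)) => g2 //.
by move: hns; rewrite negb_and -!ltNge => /orP[]; nra.
Qed.

Variables (x : nat -> nat -> R) (y : nat -> bool) (p : nat -> nat).

(** The potential [N / 2 * |u - theta|^2] telescopes: it starts at [N / 2 * |u|^2], stays
    nonnegative, and is unchanged in rounds that predict another level. *)
Lemma regret_le (u : nat -> R) i n : (i <= N)%N ->
  (forall s, (s < n)%N -> `|dotn d u (x s)| <= 1) ->
  (forall s, (s < n)%N -> dotn d (x s) (x s) <= 1) ->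
  \sum_(s < n) (p s == i)%:R * (dotn d u (x s) * residual N (y s) i) <=
  \sum_(s < n) (p s == i)%:R * (play N d x y p s i * residual N (y s) i +
                                N%:R^-1 / 2) + N%:R / 2 * dotn d u u.
Proof.
move=> iN hu hx.
pose D m j := u j - theta N d x y p m i j.
suff H m : (m <= n)%N ->
    \sum_(s < m) (p s == i)%:R * (dotn d u (x s) * residual N (y s) i) +
    N%:R / 2 * dotn d (D m) (D m) <=
    \sum_(s < m) (p s == i)%:R * (play N d x y p s i * residual N (y s) i +
                                N%:R^-1 / 2) + N%:R / 2 * dotn d u u.
  apply: le_trans (H n (leqnn n)); rewrite lerDl mulr_ge0 // ?divr_ge0 //.
  by apply: sumr_ge0 => j _; rewrite -expr2 sqr_ge0.
elim: m => [_|m IH mn].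
  rewrite !big_ord0 !add0r /D /=.
  by rewrite (_ : (fun j => _) = u) //; apply/funext => j; rewrite subr0.
have {}IH := IH (ltnW mn).
rewrite !big_ord_recr /=; have [pi|pi] := eqVneq (p m) i; last first.
  rewrite !mul0r !addr0; apply: le_trans IH; rewrite lerD2l.
  rewrite /D /= eq_sym (negbTE pi);
  by rewrite le_eqVlt; apply/orP; left; apply/eqP; congr (_ * _);
     apply: eq_bigr => j _; rewrite mul0r addr0.
rewrite !mul1r.
set v := dotn d u (x m); set c := residual N (y m) i.
set g := dotn d (theta N d x y p m i) (x m).
have Dm : dotn d (D m.+1) (D m.+1) = dotn d (D m) (D m) +
    (step N g c ^+ 2 * dotn d (x m) (x m) - 2 * step N g c * (v - g)).
  rewrite /v /g /dotn -sumrB -/g !mulr_sumr -sumrB -big_split /=.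
  apply: eq_bigr => j _; rewrite /D /= pi eqxx -/g -/c mul1r.
  by ring.
have := @regret_step v g c (dotn d (x m) (x m)) (hu m mn) (residual_norm_le1 _ iN).
have -> : 0 <= dotn d (x m) (x m) <= 1.
  by rewrite hx // andbT; apply: sumr_ge0 => j _; rewrite -expr2 sqr_ge0.
move=> /(_ isT); rewrite /play -/g Dm mulrDr.
by lra.
Qed.

End Regret.

(** * Reduction to unnormalized sums, and the geometry of [Flin1] *)

Section SMCalBounds.
Context {R : realType}.

(** For exponent 1 the count of a level cancels the denominator of [rho]. *)
Lemma SMCal_le (X : Type) (T N : nat) (x : T.-tuple X) (y : T.-tuple bool)
    (p : T.-tuple 'I_N.+1) (F : set (X -> R)) (b : 'I_N.+1 -> R) :
  (forall i, 0 <= b i) ->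
  (forall i f, F f ->
     `|\sum_(t < T) (tnth p t == i)%:R * f (tnth x t)
          * ((tnth y t)%:R - gridpt i)| <= b i) ->
  (SMCal x y p F 1 <= (\sum_i b i)%:E)%E.
Proof.
move=> b0 hb; rewrite /SMCal -sumEFin; apply: lee_sum => i _.
have n0 : 0 <= npred p i :> R by apply: sumr_ge0 => t _; exact: ler0n.
(* A level that is never predicted contributes 0, even if the supremum were infinite. *)
have [n0'|n1] := eqVneq (npred p i : R) 0.
  by rewrite n0' mul0e lee_fin.
have n_gt0 : 0 < npred p i :> R by rewrite lt_neqAle eq_sym n1.
have -> : (b i)%:E = ((npred p i)%:E * (b i / npred p i)%:E)%E.
  by rewrite -EFinM; congr EFin; field.
apply: lee_wpmul2l; first by rewrite lee_fin.
apply: ge_ereal_sup => _ [f Ff <-]; rewrite lee_fin powRr1 ?normr_ge0 //.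
by rewrite /rho normrM normfV (ger0_norm n0) ler_pM2r ?invr_gt0 // hb.
Qed.

(* Test points: [e_1 / 2], and [e_1 / 2 + w / (2 |w|)], where [w] is [u] with
   its first coordinate erased. *)
Lemma Flin1_sqnorm_le d (u : 'rV[R]_d) : Flin1 (dot u) -> dot u u <= 20.
Proof.
case: d u => [|d] u; first by rewrite /dot big_ord0 ler0n.
move=> [_ hf].
have hctx (v : 'rV[R]_d.+1) : v 0 ord0 = 1 / 2 -> dot v v <= 1 ->
    `|dot u v| <= 1.
  move=> v0 v1; have : context_space v.
    split=> [|i i0]; last by rewrite -v0; congr (v _ _); exact: val_inj.
    by rewrite /l2norm -sqrtr1 ler_wsqrtr.
  by move=> /hf; rewrite -real_normK ?num_real // expr_le1.
pose W := \sum_(i < d) u 0 (lift ord0 i) ^+ 2.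
have W0 : 0 <= W by apply: sumr_ge0 => i _; exact: sqr_ge0.
have -> : dot u u = u 0 ord0 ^+ 2 + W.
  by rewrite /dot big_ord_recl -expr2; congr (_ + _); apply: eq_bigr => i _.
pose v a : 'rV[R]_d.+1 :=
  \row_i (if i == ord0 then 1 / 2 else a * u 0 i).
have dv a b c : b = (1 / 2) ^+ 2 + a ^+ 2 * W -> 
    c = u 0 ord0 / 2 + a * W -> b <= 1 -> `|c| <= 1.
  move=> -> -> hb.
  have <- : dot u (v a) = u 0 ord0 / 2 + a * W.
    rewrite /dot big_ord_recl !mxE /= mul1r; congr (_ + _).
    by rewrite mulr_sumr; apply: eq_bigr => i _; rewrite !mxE /=; ring.
  apply: hctx; first by rewrite mxE.
  apply: le_trans hb; rewrite le_eqVlt; apply/orP; left; apply/eqP.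
  rewrite /dot big_ord_recl !mxE /= expr2; congr (_ + _).
  by rewrite mulr_sumr; apply: eq_bigr => i _; rewrite !mxE /=; ring.
have /ler_normlP[u1 u2] : `|u 0 ord0 / 2| <= 1.
  by apply: (@dv 0 _ _ erefl); [ring|lra].
set s := Num.sqrt W; have s0 : 0 <= s := sqrtr_ge0 _.
have sW : s ^+ 2 = W by rewrite sqr_sqrtr.
have [sz|sz] := eqVneq s 0.
  by rewrite -sW sz; nra.
have /ler_normlP[u3 u4] : `|u 0 ord0 / 2 + s / 2| <= 1.
  apply: (@dv (1 / (2 * s)) (2^-1)); rewrite -?sW; last by lra.
    by field.
  by field.
(* The two tests give [|u 0 ord0| <= 2] and [s <= 2 - u 0 ord0 <= 4], whence 4 + 16 = 20. *)
by rewrite -sW; nra.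
Qed.

(** This symmetry turns one-sided regret bounds into bounds on absolute values. *)
Lemma Flin1_opp d (u : 'rV[R]_d) : Flin1 (dot u) -> Flin1 (dot (- u)).
Proof.
move=> [_ h]; split=> [|v /h]; first by exists (- u).
rewrite (_ : dot (- u) v = - dot u v) ?sqrrN // /dot -sumrN.
by apply: eq_bigr => i _; rewrite mxE mulNr.
Qed.

End SMCalBounds.

(** * The forecaster and its efficiency *)

Section Algorithm.
Context {R : realType}.

(** Extension by zeros, as in the real array of [input]. *)
Definition coords d (v : 'rV[R]_d) (j : nat) : R :=
  if insub j is Some i then v 0 i else 0.

Lemma dotn_coords d (u v : 'rV[R]_d) : dotn d (coords u) (coords v) = dot u v.
Proof. by apply: eq_bigr => i _; rewrite /coords valK. Qed.

(** Causality: [theta] in round [t] reads only earlier rounds, so full sequences can replace the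
    prefixes that the forecaster sees. *)
Lemma eq_theta N d (x x' : nat -> nat -> R) y y' p p' t :
  (forall s, (s < t)%N -> [/\ x s = x' s, y s = y' s & p s = p' s]) ->
  theta N d x y p t = theta N d x' y' p' t.
Proof.
elim: t => //= t IH h; rewrite IH; last by move=> s st; apply: h; exact: ltnW.
by have [-> -> ->] := h t (ltnSn t).
Qed.

Section Histories.
Variables (N d : nat).

(** The round number is [size ys], which is also the position of the current context in [xs]. *)
Definition round_play (xs : seq 'rV[R]_d) (ys : seq bool) (ps : seq nat) :
    nat -> R :=
  play N d (fun s => coords (nth 0 xs s)) (nth false ys) (nth 0%N ps) (size ys).

Definition round_law xs ys (ps : seq 'I_N.+1) (i : 'I_N.+1) : R :=
  weight N (round_play xs ys (map val ps)) i.

Lemma round_law_ge0 xs ys ps i : 0 <= round_law xs ys ps i.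
Proof. exact: weight_ge0. Qed.

Lemma round_law_sum1 xs ys ps : \sum_i round_law xs ys ps i = 1.
Proof. exact: sum_weight1. Qed.

End Histories.

Definition algorithm (T d : nat) : forecaster R d :=
  Forecaster (grid_size_gt0 T) (@round_law_ge0 (grid_size T) d)
             (@round_law_sum1 (grid_size T) d).

Lemma algorithm_efficient : efficient algorithm.
Proof.
(* As a variable, the constant is never expanded into a unary numeral. *)
have [c hc] : exists c, c = 4000%N by exists 4000%N.
exists main_prog, c, 2 => T d T2 d1 xs ys ps tT xsz psz _.
have T0 : (0 < T)%N by exact: ltnW.
have NT := grid_size_le T0.
have : wp main_prog (input T xs ys ps) (1000 * (T + d).+1 ^ 2 - (grid_size T).+1)
    (fun s' : state (R := R) => nmem s' 5 [::] = grid_size T /\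
       forall i, rmem s' 1 [:: i] = weight (grid_size T)
         (round_play (grid_size T) xs ys (map val ps)) i).
  by apply: main_progP.
rewrite /wp; set r := exec _ _; clearbody r => -[[H5 H1] HK].
split; [|exact: H5|by move=> i; exact: H1].
apply: (@leq_trans (1000 * (T + d).+1 ^ 2)); last by rewrite hc -!mulnn; nia.
have h : ((grid_size T).+1 <= 1000 * (T + d).+1 ^ 2)%N by rewrite -mulnn; nia.
by rewrite -(subnK h) leq_add2r.
Qed.

End Algorithm.

(** * Error bounds for the random run *)

Section Protocol.
Context {R : realType}.
Variables (T d : nat) (x : T.-tuple 'rV[R]_d) (y : T.-tuple bool).
Let N := grid_size T.
Let N_gt0 : 0 < N%:R :> R. Proof. by rewrite ltr0n grid_size_gt0. Qed.

Definition played (p : T.-tuple 'I_N.+1) : nat -> nat -> R :=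
  play N d (fun s => coords (nth 0 x s)) (nth false y) (nth 0%N (map val p)).

(** The total payoff of the learners at the levels actually predicted: the only random term in the
    final bound. *)
Definition gain (p : T.-tuple 'I_N.+1) : R :=
  \sum_(t < T) played p t (tnth p t) * residual N (tnth y t) (tnth p t).

Lemma round_play_take (p : T.-tuple 'I_N.+1) (t : 'I_T) :
  round_play N (take t.+1 x) (take t y) (map val (take t p)) = played p t.
Proof.
have sz : size (take t y) = t by rewrite size_takel // size_tuple ltnW.
apply/funext => i; rewrite /round_play /played /play sz nth_take //.
congr (clip (dotn _ (_ i) _)); apply: eq_theta => s st.
by rewrite map_take !nth_take // ltnS ltnW.
Qed.

Lemma nth_val_tuple (p : T.-tuple 'I_N.+1) (t : 'I_T) :
  nth 0%N (map val p) t = tnth p t.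
Proof. by rewrite (nth_map ord0) ?size_tuple // -tnth_nth. Qed.

Lemma sum_tnth_eq (p : T.-tuple 'I_N.+1) (F : 'I_T -> 'I_N.+1 -> R) :
  \sum_(i < N.+1) \sum_(t < T) (tnth p t == i)%:R * F t i =
  \sum_(t < T) F t (tnth p t).
Proof.
rewrite exchange_big; apply: eq_bigr => t _ /=.
rewrite (bigD1 (tnth p t)) //= eqxx mul1r big1 ?addr0 // => i ne.
by rewrite eq_sym (negbTE ne) mul0r.
Qed.

(** Regret bounds each level with [N / 2 * 20 = 10 * N] as initial potential; summed over levels,
    the indicators select in each round the level predicted. *)
Lemma SMCal_le_gain (p : T.-tuple 'I_N.+1) :
  (forall t, context_space (tnth x t)) ->
  (SMCal x y p Flin1 1 <=
   (gain p + T%:R * (N%:R^-1 / 2) + N.+1%:R * (10 * N%:R))%:E)%E.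
Proof.
move=> hx.
pose b (i : 'I_N.+1) : R :=
  \sum_(t < T) (tnth p t == i)%:R *
     (played p t i * residual N (tnth y t) i + N%:R^-1 / 2) + 10 * N%:R.
have hb (u : 'rV[R]_d) (i : 'I_N.+1) : Flin1 (dot u) ->
    \sum_(t < T) (tnth p t == i)%:R *
       (dot u (tnth x t) * residual N (tnth y t) i) <= b i.
  move=> Fu; have [_ fu] := Fu.
  have xt (t : 'I_T) : coords (nth 0 x t) = coords (tnth x t).
    by rewrite (tnth_nth 0).
  have yt (t : 'I_T) : nth false y t = tnth y t by rewrite (tnth_nth false).
  have -> : \sum_(t < T) (tnth p t == i)%:R *
       (dot u (tnth x t) * residual N (tnth y t) i) =
    \sum_(t < T) (nth 0%N (map val p) t == i)%:R *
       (dotn d (coords u) (coords (nth 0 x t)) * residual N (nth false y t) i).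
    by apply: eq_bigr => t _; rewrite nth_val_tuple xt dotn_coords yt.
  have Hr := @regret_le R N d (grid_size_gt0 T) (fun s => coords (nth 0 x s))
    (nth false y) (nth 0%N (map val p)) (coords u) i T.
  apply: le_trans (Hr _ _ _) _.
  - by rewrite -ltnS.
  - move=> s sT; rewrite (xt (Ordinal sT)) dotn_coords.
    by have := fu _ (hx (Ordinal sT)); rewrite -real_normK ?num_real // expr_le1.
  - move=> s sT; rewrite (xt (Ordinal sT)) dotn_coords.
    have [+ _] := hx (Ordinal sT); rewrite /l2norm -[X in _ <= X]sqrtr1.
    by rewrite ler_sqrt ?ler01.
  rewrite dotn_coords; apply: lerD; last first.
    have -> : 10 * N%:R = N%:R / 2 * 20 :> R by field.
    by apply: ler_wpM2l (Flin1_sqnorm_le Fu); rewrite divr_ge0.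
  by rewrite le_eqVlt; apply/orP; left; apply/eqP; apply: eq_bigr => t _;
    rewrite nth_val_tuple yt.
have hb' (i : 'I_N.+1) f : Flin1 f ->
    `|\sum_(t < T) (tnth p t == i)%:R * f (tnth x t)
        * ((tnth y t)%:R - gridpt i)| <= b i.
  move=> Ff; have [[u _ fE] _] := Ff; rewrite -fE in Ff *.
  apply/ler_normlP; split.
    apply: le_trans (hb _ _ (Flin1_opp Ff)).
    rewrite -sumrN ler_sum // => t _.
    rewrite (_ : dot (- u) _ = - dot u (tnth x t)).
      by rewrite le_eqVlt; apply/orP; left; apply/eqP; rewrite /residual /gridpt; ring.
    by rewrite /dot -sumrN; apply: eq_bigr => j _; rewrite mxE mulNr.
  apply: le_trans (hb _ _ Ff); rewrite ler_sum // => t _.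
  by rewrite mulrA.
(* Comparison with the zero function. *)
have b0 i : 0 <= b i.
  apply: le_trans (hb' i (dot 0) _); first exact: normr_ge0.
  split=> [|v _]; first by exists 0.
  by rewrite /dot big1 ?expr0n ?ler01 // => j _; rewrite mxE mul0r.
apply: le_trans (SMCal_le b0 hb') _.
rewrite lee_fin /b big_split /= sum_tnth_eq big_split /= -/(gain p).
by rewrite !sumr_const !card_ord -[_ *+ T]mulr_natl -[_ *+ N.+1]mulr_natl.
Qed.

(** Each summand is at most 1 in absolute value, so a level contributes at most its count. This
    covers the regimes in which the target exceeds [T]. *)
Lemma SMCal_le_horizon (p : T.-tuple 'I_N.+1) :
  (forall t, context_space (tnth x t)) ->
  (SMCal x y p Flin1 1 <= (T%:R : R)%:E)%E.
Proof.
move=> hx.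
have -> : T%:R = \sum_(i < N.+1) npred p i :> R.
  rewrite /npred; under eq_bigr do under eq_bigr do rewrite -[_%:R]mulr1.
  by rewrite (sum_tnth_eq p (fun _ _ => 1)) sumr_const card_ord.
apply: SMCal_le => [i|i f [_ hf]]; first by apply: sumr_ge0 => t _; exact: ler0n.
apply: le_trans (ler_norm_sum _ _ _) _; apply: ler_sum => t _.
rewrite !normrM normr_nat -mulrA ler_piMr ?ler0n //.
apply: mulr_ile1 => //.
  by have := hf _ (hx t); rewrite -real_normK ?num_real // expr_le1.
by apply: (residual_norm_le1 (grid_size_gt0 T)); rewrite -ltnS.
Qed.

Lemma run_probE (p : T.-tuple 'I_N.+1) :
  run_prob (A := algorithm T d) x y p =
  \prod_(t < T) round_law (take t.+1 x) (take t y) (take t p) (tnth p t).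
Proof. by []. Qed.

Lemma run_prob_ge0 (p : T.-tuple 'I_N.+1) :
  0 <= run_prob (A := algorithm T d) x y p.
Proof. by apply: prodr_ge0 => t _; exact: law_ge0. Qed.

Lemma sum_run_prob :
  \sum_(p : T.-tuple 'I_N.+1) run_prob (A := algorithm T d) x y p = 1.
Proof.
(* The round number is recovered from the history as [size h]. *)
have H := sum_tuple_prod1 (G := fun h => round_law (take (size h).+1 x)
  (take (size h) y) h) T (fun h => @round_law_sum1 R N d _ _ h).
rewrite -[RHS]H; apply: eq_bigr => p _; rewrite run_probE; apply: eq_bigr => t _.
by rewrite size_takel // size_tuple ltnW.
Qed.

(** Given any history, a round multiplies the exponential moment by at most
    [expR (l / N + 2 * l^2)]; centring at [T / N] removes the first term. *)
Lemma gain_mgf_le (l : R) : 0 <= l <= 2^-1 ->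
  \sum_(p : T.-tuple 'I_N.+1) run_prob (A := algorithm T d) x y p *
    expR (l * (gain p - T%:R / N%:R)) <= expR (2 * l ^+ 2 * T%:R).
Proof.
move=> hl.
pose G (h : seq 'I_N.+1) (i : 'I_N.+1) : R :=
  round_law (take (size h).+1 x) (take (size h) y) h i *
  expR (l * (round_play N (take (size h).+1 x) (take (size h) y) (map val h) i *
             residual N (nth false y (size h)) i)).
have G0 h i : 0 <= G h i by rewrite mulr_ge0 ?round_law_ge0 ?expR_ge0.
have GK h : \sum_i G h i <= expR (l * N%:R^-1 + 2 * l ^+ 2).
  apply: (mgf_le (X := fun i : 'I_N.+1 => round_play N (take (size h).+1 x)
      (take (size h) y) (map val h) i * residual N (nth false y (size h)) i)) => //.
  - by move=> i; exact: round_law_ge0.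
  - exact: round_law_sum1.
  - move=> i; rewrite normrM mulr_ile1 // ?clip_norm_le1 //.
    by apply: (residual_norm_le1 (grid_size_gt0 T)); rewrite -ltnS.
  - apply: sum_weight_residual; first exact: grid_size_gt0.
    by move=> i; exact: clip_norm_le1.
have := sum_tuple_prod_le T G0 GK; rewrite -expRM_natl => H.
apply: (le_trans (y := \sum_(p : T.-tuple 'I_N.+1)
   (\prod_(t < T) G (take t p) (tnth p t)) * expR (- (l * (T%:R / N%:R))))).
  apply: ler_sum => p _; rewrite le_eqVlt; apply/orP; left; apply/eqP.
  rewrite mulrBr expRD mulrA; congr (_ * _).
  rewrite run_probE /gain mulr_sumr expR_sum -big_split /=.
  apply: eq_bigr => t _; rewrite /G.
  have -> : size (take t p) = t by rewrite size_takel // size_tuple ltnW.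
  by rewrite round_play_take -tnth_nth.
rewrite -mulr_suml; apply: (le_trans (ler_wpM2r (expR_ge0 _) H)).
by rewrite -expRD ler_expR le_eqVlt; apply/orP; left; apply/eqP; field; rewrite gt_eqF.
Qed.

(** With [l = 1 / (2 * sqrt T)] the exponential moment is at most [expR (1 / 2) <= 2]; then
    [1 + z <= expR z] bounds the centred mean by [1 / l]. *)
Lemma expect_gain_le : (0 < T)%N ->
  \sum_(p : T.-tuple 'I_N.+1) run_prob (A := algorithm T d) x y p * gain p <=
  T%:R / N%:R + 2 * Num.sqrt T%:R.
Proof.
move=> T0; set s := Num.sqrt T%:R.
have T1 : 1 <= T%:R :> R by rewrite ler1n.
have s2 : s ^+ 2 = T%:R by rewrite sqr_sqrtr // ler0n.
have s0 : 0 <= s by exact: sqrtr_ge0.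
have s1 : 1 <= s by nra.
have si : 0 < s^-1 <= 1 by rewrite invr_gt0 invf_le1; lra.
have hl : 0 <= s^-1 / 2 <= 2^-1 by move: si; lra.
have := gain_mgf_le hl.
have -> : 2 * (s^-1 / 2) ^+ 2 * T%:R = 2^-1 by rewrite -s2; field; lra.
have e2 : expR 2^-1 <= 2 :> R.
  by apply: le_trans (expR_le_quadratic (lexx _)) _; lra.
move=> /le_trans /(_ e2) H.
have : \sum_(p : T.-tuple 'I_N.+1) run_prob (A := algorithm T d) x y p *
    (1 + s^-1 / 2 * (gain p - T%:R / N%:R)) <= 2.
  apply: le_trans H; apply: ler_sum => p _; apply: ler_wpM2l (expR_ge1Dx _).
  exact: run_prob_ge0.
rewrite (eq_bigr (fun p => run_prob (A := algorithm T d) x y p *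
     (1 - s^-1 / 2 * (T%:R / N%:R)) +
     run_prob (A := algorithm T d) x y p * gain p * (s^-1 / 2))); last first.
  by move=> p _; ring.
rewrite big_split /= -!mulr_suml sum_run_prob.
set E := \sum_(p : _) _; rewrite mul1r => h.
have h2 : (E - T%:R / N%:R) * (s^-1 / 2) <= 1 by lra.
have : E - T%:R / N%:R <= 2 * s.
  have -> : E - T%:R / N%:R = (E - T%:R / N%:R) * (s^-1 / 2) * (2 * s).
    by field; apply/andP; split; [lra|rewrite gt_eqF].
  by rewrite -[leRHS]mul1r ler_wpM2r //; lra.
by lra.
Qed.

(** Chernoff bound with [l = sqrt L / (2 * sqrt T)]; the assumption [L <= T] ensures
    [l <= 1 / 2]. *)
Lemma gain_tail (L : R) : (0 < T)%N -> 0 <= L <= T%:R ->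
  1 - expR (- L) <= \sum_(p : T.-tuple 'I_N.+1 |
     gain p <= T%:R / N%:R + 3 * (Num.sqrt T%:R * Num.sqrt L))
     run_prob (A := algorithm T d) x y p.
Proof.
move=> T0 /andP[L0 LT]; set s := Num.sqrt T%:R; set r := Num.sqrt L.
have T1 : 1 <= T%:R :> R by rewrite ler1n.
have s2 : s ^+ 2 = T%:R by rewrite sqr_sqrtr // ler0n.
have r2 : r ^+ 2 = L by rewrite sqr_sqrtr.
have s0 : 0 <= s by exact: sqrtr_ge0.
have r0 : 0 <= r by exact: sqrtr_ge0.
have rs : r <= s by exact: ler_wsqrtr.
have s1 : 1 <= s by nra.
set l := r / (2 * s).
have hl : 0 <= l <= 2^-1.
  rewrite divr_ge0 ?mulr_ge0 //= /l invfM mulrA mulrAC ler_piMl ?ler_pdivrMr; lra.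
have := gain_mgf_le hl.
have -> : 2 * l ^+ 2 * T%:R = L / 2 by rewrite -s2 -r2 /l; field; lra.
move=> H; have := sum_run_prob.
rewrite (bigID (fun p => gain p <= T%:R / N%:R + 3 * (s * r))) /= => /esym h1.
rewrite lerBlDr [leLHS]h1 lerD2l {h1}.
(* The exponential moment costs [L / 2] and the threshold gains [3 * L / 2]. *)
have -> : - L = L / 2 + - (l * (3 * (s * r))).
  by rewrite -r2 /l; field; lra.
rewrite expRD; apply: le_trans (ler_wpM2r (expR_ge0 _) H).
rewrite mulr_suml [leRHS](bigID (fun p => gain p <= T%:R / N%:R + 3 * (s * r))) /=.
apply: ler_wpDl.
  by apply: sumr_ge0 => p _; rewrite !mulr_ge0 ?run_prob_ge0 ?expR_ge0.
apply: ler_sum => p; rewrite -ltNge => hp.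
rewrite -mulrA -expRD ler_peMr ?run_prob_ge0 // -[leLHS]expR0 ler_expR -mulrBr.
have /andP[l0 _] := hl; apply: mulr_ge0 => //.
by rewrite -addrA -opprD subr_ge0 ltW.
Qed.

End Protocol.

(** * Comparison of the error terms with the target rate *)

Section Rates.
Context {R : realType}.
Variables (T d : nat).
Hypotheses (T_ge2 : (2 <= T)%N) (d_gt0 : (1 <= d)%N).
Let N := grid_size T.
Let tau : R := T%:R `^ (1 / 3).
Let rate : R := T%:R `^ (2 / 3) * d%:R `^ (1 / 3) * ln T%:R `^ (1 / 3).

Let T_ge2R : 2 <= T%:R :> R. Proof. by rewrite ler_nat. Qed.
Let N_gt0 : 0 < N%:R :> R. Proof. by rewrite ltr0n grid_size_gt0. Qed.

Let tau3 : tau ^+ 3 = T%:R.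
Proof.
by rewrite -powR_mulrn ?powR_ge0 // -powRrM mul1r mulVf ?powRr1.
Qed.

Let tau2 : T%:R `^ (2 / 3) = tau ^+ 2.
Proof.
by rewrite -powR_mulrn ?powR_ge0 // -powRrM; congr (_ `^ _); field.
Qed.

Let tau_ge1 : 1 <= tau.
Proof.
rewrite -(@ler_pXn2r _ 3) ?nnegrE ?powR_ge0 ?ler01 // expr1n tau3.
by move: T_ge2R; lra.
Qed.

Let grid_le_tau : N%:R <= tau.
Proof.
rewrite -(@ler_pXn2r _ 3) ?nnegrE ?powR_ge0 ?ler0n // tau3.
by rewrite !exprS expr0 mulr1 -!natrM ler_nat mulnA grid_size_cube_le // ltnW.
Qed.

Let tau_le_grid : tau <= 2 * N%:R.
Proof.
rewrite -(@ler_pXn2r _ 3) ?nnegrE ?powR_ge0 ?mulr_ge0 ?ler0n // tau3.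
rewrite !exprS expr0 mulr1 -!natrM ler_nat.
have := grid_size_cube_gt T; have := grid_size_gt0 T; rewrite -/N.
by move: N => n n0; nia.
Qed.

Lemma ln2_ge_half : 2^-1 <= ln T%:R :> R.
Proof.
have e2 : expR 2^-1 <= 2 :> R.
  by apply: le_trans (expR_le_quadratic (lexx _)) _; lra.
rewrite -[leLHS]expRK ler_ln ?posrE ?expR_gt0 ?(le_trans e2) //.
by move: T_ge2R; lra.
Qed.

(** The rate is [tau^2 * (d * ln T)^(1/3)], and the last factor is at least [tau] here. *)
Lemma horizon_rate_le : T%:R <= d%:R * ln T%:R :> R -> T%:R <= rate.
Proof.
move=> h; rewrite /rate tau2 -mulrA -powRM ?ler0n //; last first.
  by have := ln2_ge_half; lra.
rewrite -[leLHS]tau3 exprSr ler_wpM2l ?exprn_ge0 ?powR_ge0 //.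
by apply: ge0_ler_powR; rewrite ?nnegrE ?(le_trans _ h) ?ler0n // divr_ge0.
Qed.

(** Since [ln T >= 1 / 2], its cube root is at least [1 / 2]; this is the source of the factor 2. *)
Lemma tau2_le_rate : tau ^+ 2 <= 2 * rate.
Proof.
have d1 : 1 <= d%:R `^ (1 / 3) :> R.
  rewrite -[leLHS](powRr0 d%:R); apply: ler_powR; first by rewrite ler1n.
  by rewrite divr_ge0.
have l1 : 2^-1 <= ln T%:R `^ (1 / 3) :> R.
  have [l1|l1] := leP 1 (ln T%:R : R).
    apply: (@le_trans _ _ 1); first by lra.
    by rewrite -[leLHS](powRr0 (ln T%:R)); apply: ler_powR; rewrite ?divr_ge0.
  apply: (@le_trans _ _ (2^-1 `^ (1 / 3))).
    rewrite -[leLHS]powRr1 //; apply: ger_powR; last by lra.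
    by lra.
  apply: ge0_ler_powR; rewrite ?nnegrE ?divr_ge0 ?ln2_ge_half //.
  by apply: le_trans ln2_ge_half.
rewrite /rate tau2; have t2 : 0 <= tau ^+ 2 by exact: sqr_ge0.
rewrite -mulrA mulrCA -[leLHS]mulr1; apply: ler_wpM2l => //.
by nra.
Qed.

(** In units of [tau^2] the three terms are at most 2, 1 and 20, and [tau^2 <= 2 * rate]. *)
Lemma deterministic_le :
  T%:R / N%:R + T%:R * (N%:R^-1 / 2) + N.+1%:R * (10 * N%:R) <= 46 * rate.
Proof.
apply: (@le_trans _ _ (23 * tau ^+ 2)); last by have := tau2_le_rate; lra.
have h : T%:R / N%:R <= 2 * tau ^+ 2.
  rewrite ler_pdivrMr // -tau3 exprSr -[leLHS]mulrC.
  by have := ler_wpM2r (sqr_ge0 tau) tau_le_grid; lra.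
have h2 : T%:R * (N%:R^-1 / 2) <= tau ^+ 2.
  by rewrite mulrA ler_pdivrMr // [leRHS]mulrC.
have N1 : 1 <= N%:R :> R by rewrite ler1n grid_size_gt0.
have h3 : N%:R * N%:R <= tau ^+ 2.
  by rewrite expr2; apply: ler_pM; rewrite ?ler0n.
have h4 : N%:R <= tau ^+ 2 by apply: le_trans h3; rewrite ler_peMl.
by rewrite -[N.+1%:R]natr1; lra.
Qed.

Lemma sqrt_le_tau2 : Num.sqrt T%:R <= tau ^+ 2.
Proof.
rewrite -[leRHS]ger0_norm ?sqr_ge0 // -sqrtr_sqr ler_wsqrtr //.
by rewrite -exprM -tau3 ler_weXn2l.
Qed.

(** Writing [sqrt T = T^(2/3) * T^(-1/6)], the negative power decreases in its base. *)
Lemma sqrt_le_deviation : d%:R * ln T%:R <= T%:R :> R ->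
  Num.sqrt T%:R <= T%:R `^ (2 / 3) * (d%:R * ln T%:R) `^ (- (1 / 6)) :> R.
Proof.
move=> h; have d1 : 1 <= d%:R :> R by rewrite ler1n.
have l0 := ln2_ge_half.
have m0 : 0 < d%:R * ln T%:R :> R by apply: mulr_gt0; lra.
have -> : Num.sqrt T%:R = T%:R `^ (2 / 3) * T%:R `^ (- (1 / 6)) :> R.
  rewrite -powR12_sqrt // -powRD; last by rewrite gt_eqF ?implybT //; lra.
  by congr (_ `^ _); field.
apply: ler_wpM2l; first exact: powR_ge0.
rewrite !powRN lef_pV2 ?posrE ?powR_gt0 //; last by lra.
by apply: ge0_ler_powR; rewrite ?nnegrE ?divr_ge0 // ltW.
Qed.

End Rates.

(** * The high-probability and expectation bounds *)

Theorem corollary1 (R : realType) :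
  exists2 C : R, 0 < C &
  exists2 A : forall T d : nat, forecaster R d, efficient A &
  forall T d : nat, (2 <= T)%N -> (1 <= d)%N ->
  forall (x : T.-tuple 'rV[R]_d) (y : T.-tuple bool),
    (forall t : 'I_T, context_space (tnth x t)) ->
    (forall delta : R, 0 < delta < 1 ->
       1 - delta <=
       Pr (A := A T d) x y (fun p =>
         (SMCal x y p Flin1 1 <=
          (C * (T%:R `^ (2 / 3) * d%:R `^ (1 / 3) * ln T%:R `^ (1 / 3)
                + T%:R `^ (2 / 3) * (d%:R * ln T%:R) `^ (- (1 / 6))
                  * Num.sqrt (ln (1 / delta))))%:E)%E))
    /\
    (Expect (A := A T d) x y (fun p => SMCal x y p Flin1 1) <=
     (C * (T%:R `^ (2 / 3) * d%:R `^ (1 / 3) * ln T%:R `^ (1 / 3)))%:E)%E.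
Proof.
(* 46 comes from the deterministic terms and 4 from [2 * sqrt T <= 2 * tau^2 <= 4 * rate] in the
   expectation; the tail bound uses 3 for the deviation. *)
exists 50 => //; exists (@algorithm R); first exact: algorithm_efficient.
move=> T d T2 d1 x y hx.
have T0 : (0 < T)%N by exact: ltnW.
have hdet := deterministic_le T2 d1 (R := R).
have htau := tau2_le_rate T2 d1 (R := R).
have hsq := sqrt_le_tau2 T2 (R := R).
set rate := _ * _ * ln _ `^ _ in hdet htau *.
have rate0 : 0 <= rate by rewrite !mulr_ge0 ?powR_ge0.
split=> [delta /andP[del0 del1]|].
  set L := ln (1 / delta).
  have eL : expR (- L) = delta by rewrite /L div1r lnV ?posrE // opprK lnK ?posrE.
  have L0 : 0 <= L by rewrite ln_ge0 // div1r invf_ge1 // ltW.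
  set dev := _ * _ * Num.sqrt L.
  have dev0 : 0 <= dev by rewrite !mulr_ge0 ?powR_ge0 ?sqrtr_ge0.
  rewrite -eL /Pr.
  (* If the target is at least [T], the event is certain. *)
  have always : T%:R <= 50 * (rate + dev) -> 1 - expR (- L) <=
      \sum_(p | (SMCal x y p Flin1 1 <= (50 * (rate + dev))%:E)%E)
        run_prob (A := algorithm T d) x y p.
    move=> hT; rewrite (eq_bigl xpredT) => [|p]; last first.
      by apply: le_trans (SMCal_le_horizon y p hx) _; rewrite lee_fin.
    by rewrite sum_run_prob lerBlDr lerDl expR_ge0.
  have [hT|/ltW hT] := leP T%:R (d%:R * ln T%:R : R).
    by apply: always; have := horizon_rate_le T2 hT; rewrite -/rate; lra.
  have hdev : Num.sqrt T%:R * Num.sqrt L <= dev.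
    by apply: ler_wpM2r (sqrt_le_deviation T2 d1 hT); exact: sqrtr_ge0.
  (* For [L > T] the deviation term alone is at least [sqrt T * sqrt L >= T]. *)
  have [LT|LT] := leP L T%:R; last first.
    apply: always; have s2 : Num.sqrt T%:R ^+ 2 = T%:R :> R by rewrite sqr_sqrtr.
    have : Num.sqrt T%:R * Num.sqrt T%:R <= Num.sqrt T%:R * Num.sqrt L :> R.
      by apply: ler_wpM2l; rewrite ?sqrtr_ge0 // ler_wsqrtr // ltW.
    by rewrite -expr2 s2; lra.
  apply: le_trans (gain_tail x y T0 _) _; first by rewrite L0 LT.
  rewrite [leRHS]big_mkcond [leLHS]big_mkcond /=; apply: ler_sum => p _.
  case: ifPn => hp; last by case: ifP => // _; exact: run_prob_ge0.
  rewrite ifT //; apply: le_trans (SMCal_le_gain y p hx) _.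
  by rewrite lee_fin; lra.
apply: (@le_trans _ _ (\sum_p (run_prob (A := algorithm T d) x y p *
   (gain x y p + (T%:R * ((grid_size T)%:R^-1 / 2) +
      (grid_size T).+1%:R * (10 * (grid_size T)%:R))))%:E)%E).
  apply: lee_sum => p _; rewrite EFinM; apply: lee_wpmul2l.
    by rewrite lee_fin run_prob_ge0.
  by rewrite addrA; exact: SMCal_le_gain.
rewrite sumEFin lee_fin; under eq_bigr do rewrite mulrDr.
rewrite big_split /= -mulr_suml sum_run_prob mul1r.
by have := expect_gain_le x y T0; lra.
Qed.
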